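(* Let $\mathcal{H} = (\Phi_C,G)$ be a hybrid dynamical system on a compact metric space $X$, and assume that the closed set $K\subset X$ is an isolating neighborhood for a viable set $A$ (that is, $A=K_\pm\subset K^\circ$). (a) If $(P_1,P_2)$ is an $\mathcal{H}$ index pair rel $K$ for $A$, then $K_- \subset P_1$ and $K_+ \cap P_2 = \emptyset$. In addition, $\delta_{\mathcal{H}}(P_1) \subset P_1 \cap \partial K \subset P_2$. In addition, if $\overline{P_1\setminus P_2}\subset K^\circ$, then for some $\epsilon > 0$, $\delta_{(\phi_C)^{[0,\epsilon]}}(P_1) \subset P_2$. (b) If $U$ and $V$ are open subsets of $X$ with $K_- \subset U$ and $K_{\pm} \subset V \subset K$, then there exists an $\mathcal{H}$ index pair $(P_1,P_2)$ rel $K$ for $A$ with $P_1 \subset U$ and such that $\overline{P_1 \setminus P_2} \subset V$. In particular, $\overline{P_1\setminus P_2}\subset K^\circ$.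
   Context: A relation on $X$ is a subset $R\subset X\times X$, closed if a closed subset; $R(A)=\{y:(x,y)\in R\text{ for some }x\in A\}$, $R^{-1}=\{(y,x):(x,y)\in R\}$, $Q\circ R=\{(x,z):\exists y,\ (x,y)\in R,(y,z)\in Q\}$, $R^n$ the $n$-fold composition, $R^{-n}=(R^{-1})^n$. A semiflow relation on $X$ is a closed subset $\Phi\subset X\times[0,\infty)\times X$ such that, with $\phi^t=\{(x,y):(x,t,y)\in\Phi\}$: $\phi^0$ is the diagonal and $\phi^{t_1}\circ\phi^{t_2}=\phi^{t_1+t_2}$ for all $t_1,t_2\ge0$. For $C\subset X$ closed, $\Phi_C$ is the set of $(x,t,y)\in C\times[0,\infty)\times C$ such that there is $\mathbf{x}:[0,t]\to C$ with $\mathbf{x}(0)=x$, $\mathbf{x}(t)=y$ and $(\mathbf{x}(s_1),s_2-s_1,\mathbf{x}(s_2))\in\Phi$ for all $0\le s_1<s_2\le t$. A hybrid dynamical system on $X$ is a pair $\mathcal{H}=(\Phi_C,G)$ with $\Phi$ a semiflow relation on $X$, $C$ a nonempty closed subset of $X$ and $G$ a closed relation on $X$. For $0\le t_1\le t_2$ define $(\phi_C)^{[t_1,t_2]}=\{(x,y): (x,t,y)\in\Phi_C\cup\{(z,0,z):z\in X\}\text{ for some }t\in[t_1,t_2]\}$; $I=[0,1]$, $J=[1,2]$. The associated relation of $\mathcal{H}$ is $H=((\phi_C)^I\circ G\circ(\phi_C)^I)\cup(\phi_C)^J$. For closed $K\subset X$, the restriction is $\mathcal{H}_K=(\Phi_{C\cap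 K},G_K)$ with $G_K=G\cap(K\times K)$, and $H|K=((\phi_{C\cap K})^I\circ G_K\circ(\phi_{C\cap K})^I)\cup(\phi_{C\cap K})^J$ is its associated relation. $P\subset K$ is $\mathcal{H}_K$ + invariant if any hybrid solution path of $\mathcal{H}_K$ starting in $P$ remains in $P$; equivalently $G_K(P)\subset P$ and ($x\in P$, $(x,t,y)\in\Phi_{C\cap K}$ imply $y\in P$). $K_-=\bigcap_{k\ge1}(H|K)^k(K)$, $K_+=\bigcap_{k\ge1}(H|K)^{-k}(K)$, $K_\pm=K_-\cap K_+$; equivalently these are the sets of points of $K$ that start a forward infinite, end a backward infinite (for $K_+$, $K_-$ respectively), or lie on a bi-infinite, hybrid solution path contained in $K$. A closed set $A$ is viable if $A=A_\pm$. $\partial K=K\setminus K^\circ$; $K$ is an isolating neighborhood (for $K_\pm$) if $K_\pm\subset K^\circ$. For a relation $F$ and closed $P$: $\delta_F(P)=P\cap\overline{F(P)\setminus P}$. $\delta_{\mathcal{H}}(P)=\delta_G(P)\cup\bigcap_{\epsilon>0}\delta_{(\phi_C)^{[0,\epsilon]}}(P)$. An $\mathcal{H}$ index pair rel $K$ for $A$ ($K$ an isolating neighborhood for $A=K_\pm$) is a pair $(P_1,P_2)$ of closed subsets of $X$ with: (i) $P_2\subset P_1\subset K$; (ii) $P_1$ and $P_2$ are $\mathcal{H}_K$ + invariant; (iii) $A=K_\pm\subset P_1^\circ\setminus P_2$; (iv) $P_1\setminus P_2\subset K^\circ$. *)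

(* Defs.v *)
From HB Require Import structures.
From mathcomp Require Import all_boot all_order all_algebra.
From mathcomp Require Import all_classical all_reals all_analysis.

Set Implicit Arguments.
Unset Strict Implicit.
Unset Printing Implicit Defensive.

Import Order.TTheory GRing.Theory Num.Theory.
Import numFieldNormedType.Exports.

Local Open Scope classical_set_scope.
Local Open Scope ring_scope.

(* Relations on [T] are sets of pairs.  The library composition [Q \; S] of
   relation_scope is "first S, then Q", i.e. the usual Q o S. *)

Definition rel_image {T : Type} (F : set (T * T)) (A : set T) : set T :=
  [set y | exists2 x, A x & F (x, y)].

Fixpoint rel_iter {T : Type} (F : set (T * T)) (n : nat) : set (T * T) :=
  if n is m.+1 then (F \; rel_iter F m)%relation else diagonal.

Definition time_slice {R : realType} {X : Type} (Phi : set (X * R * X))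
    (t : R) : set (X * X) :=
  [set xy | Phi (xy.1, t, xy.2)].

(* A subset of X * [0, oo[ * X is represented as a subset of X * R * X all of
   whose times are nonnegative; since [0, oo[ is closed in R, being closed
   means the same in both spaces. *)
Definition semiflow_relation {R : realType} {X : metricType R}
    (Phi : set (X * R * X)) : Prop :=
  [/\ closed Phi,
      forall x t y, Phi (x, t, y) -> 0 <= t,
      time_slice Phi 0 = diagonal
    & forall t1 t2 : R, 0 <= t1 -> 0 <= t2 ->
        (time_slice Phi t1 \; time_slice Phi t2)%relation
          = time_slice Phi (t1 + t2)].

(* The relation Phi_C.  The path is a total function on R of which only the
   values on [0, t] matter. *)
Definition path_relation {R : realType} {X : Type} (Phi : set (X * R * X))
    (C : set X) : set (X * R * X) :=
  [set p | let: (x, t, y) := p in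
    [/\ C x, 0 <= t, C y
      & exists2 u : R -> X, (forall s : R, 0 <= s <= t -> C (u s))
          & [/\ u 0 = x, u t = y
              & forall s1 s2 : R, 0 <= s1 -> s1 < s2 -> s2 <= t ->
                  Phi (u s1, s2 - s1, u s2)]]].

(* The data (Phi, C, G) of the pair (Phi_C, G).  The axioms are kept apart, in
   [hybrid_system], because [restriction] below may have an empty flow set. *)
Record hybrid_data (R : realType) (X : metricType R) := HybridData {
  semiflow : set (X * R * X);
  flow_set : set X;
  jump : set (X * X)
}.

Section Hybrid.
Context {R : realType} {X : metricType R}.
Implicit Types (H : hybrid_data X) (K P A : set X) (F : set (X * X)).

Definition hybrid_system H : Prop :=
  [/\ semiflow_relation (semiflow H),
      flow_set H !=set0,
      closed (flow_set H)
    & closed (jump H)].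

Definition flow_between H (t1 t2 : R) : set (X * X) :=
  [set xy | exists2 t, t1 <= t <= t2
    & (path_relation (semiflow H) (flow_set H) `|` range (fun z => (z, 0, z)))
        (xy.1, t, xy.2)].

Definition associated_relation H : set (X * X) :=
  ((flow_between H 0 1 \; jump H) \; flow_between H 0 1)%relation
    `|` flow_between H 1 2.

Definition restriction H K : hybrid_data X :=
  HybridData (semiflow H) (flow_set H `&` K) (jump H `&` (K `*` K)).

Definition plus_invariant H P : Prop :=
  rel_image (jump H) P `<=` P /\
  forall x t y, P x -> path_relation (semiflow H) (flow_set H) (x, t, y) -> P y.

(* K_-, the points of K at the end of a backward infinite solution path in K;
   [forward_part] is K_+ and [viable_part] is K_\pm. *)
Definition backward_part H K : set X :=
  \bigcap_(k in [set k : nat | (1 <= k)%N])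
    rel_image (rel_iter (associated_relation (restriction H K)) k) K.

Definition forward_part H K : set X :=
  \bigcap_(k in [set k : nat | (1 <= k)%N])
    rel_image (rel_iter (associated_relation (restriction H K))^-1%relation k) K.

Definition viable_part H K : set X := backward_part H K `&` forward_part H K.

Definition isolating_neighborhood H K A : Prop :=
  [/\ closed K, A = viable_part H K & A `<=` K°].

Definition rel_delta F P : set X :=
  P `&` closure (rel_image F P `\` P).

Definition hybrid_delta H P : set X :=
  rel_delta (jump H) P `|`
  \bigcap_(e in [set e : R | 0 < e]) rel_delta (flow_between H 0 e) P.

Definition index_pair H K A (P1 P2 : set X) : Prop :=
  [/\ closed P1 /\ closed P2,
      P2 `<=` P1 /\ P1 `<=` K,
      plus_invariant (restriction H K) P1 /\
        plus_invariant (restriction H K) P2,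
      A = viable_part H K /\ A `<=` P1° `\` P2
    & P1 `\` P2 `<=` K°].

End Hybrid.

(* Main.v *)
Require Import Defs.
From mathcomp Require Import all_boot all_order all_algebra.
From mathcomp Require Import all_classical all_reals all_analysis.
From mathcomp Require Import lra.

(** Write F for the associated relation of the restriction of H to K.  It is a
    closed relation inside the compact set K, and one step of F is a piece of
    solution path that contains a jump or lasts at least one unit of time.
    Hence the images [F^n(K)] and the preimages [F^-n(K)] are decreasing
    sequences of compact sets with intersections K_- and K_+, and every
    neighborhood of K_-, K_+ or A = K_- ∩ K_+ contains a whole tail of the
    sequence [F^n(K)], [F^-n(K)] or [F^n(K) ∩ F^-n(K)].

    Part (a).  A point y of K_- ends F-chains of any length 2n in K.  The
    midpoint of such a chain lies in [F^n(K) ∩ F^-n(K)], so for n large it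
    lies in the interior of P1, and + invariance carries it to y
    ([index_pair_backward]).  A point of K_+ ∩ P2 starts chains of length 2n,
    whose midpoints would be in P2 and close to A, away from P2
    ([index_pair_forward]).  For the exit sets: solutions move uniformly little
    in a short time ([semiflow_short_time]), so a short path that ends near a
    point whose r-ball is in K stays in K, and + invariance relative to K
    forbids it to leave P1 ([local_exit]).

    Part (b).  Let V' be a neighborhood of A with closure in V.  The set
    U ∩ (V' ∪ ~K_+) is a neighborhood of K_-; P1 is a closed + invariant
    neighborhood of K_- relative to K inside it ([backward_neighborhood]), and
    P2 is everything reachable from the compact set Q = P1 \ V'.  As Q misses
    K_+, no chain from Q is longer than some n, so P2 is a finite union of
    closed sets ([reach_closed_off_forward]); as K_+ is stable under going
    backward, P2 misses A.

    The closedness of F rests on that of the path relation Phi_C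
    ([path_relation_closed]): paths, rescaled to the unit interval, form a
    closed subset of a product of copies of X, which Tychonoff makes compact. *)

Import Order.TTheory GRing.Theory Num.Theory.
Import numFieldNormedType.Exports.

Local Open Scope classical_set_scope.
Local Open Scope ring_scope.

Set Implicit Arguments.
Unset Strict Implicit.

(** * Iterates of a relation *)

Section Iterates.
Context {T : Type}.
Implicit Types (F : set (T * T)) (P : set T).

Lemma rel_iter1 F x y : rel_iter F 1 (x, y) <-> F (x, y).
Proof.
split=> [[z /= xz Fzy]|Fxy]; last by exists x.
by move/diagonalP: xz => ->.
Qed.

Lemma rel_iterD F m n x y :
  rel_iter F (m + n) (x, y) <->
  exists2 z, rel_iter F m (x, z) & rel_iter F n (z, y).
Proof.
elim: n y => [|n IH] y.
  rewrite addn0; split=> [Fxy|[z Fxz /diagonalP <-] //].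
  by exists y => //; exact/diagonalP.
rewrite addnS; split=> [[z /= /IH[w xw wz] zy]|[w xw [z /= wz zy]]].
  by exists w => //; exists z.
by exists z => //=; apply/IH; exists w.
Qed.

Lemma rel_iterSl F n x y :
  rel_iter F n.+1 (x, y) <-> exists2 z, F (x, z) & rel_iter F n (z, y).
Proof.
rewrite -(add1n n); split=> [/rel_iterD[z /rel_iter1 xz zy]|[z xz zy]].
  by exists z.
by apply/rel_iterD; exists z => //; exact/rel_iter1.
Qed.

Lemma rel_iter_inv F n x y :
  rel_iter F^-1%relation n (x, y) <-> rel_iter F n (y, x).
Proof.
elim: n x y => [|n IH] x y; first by split=> /diagonalP ->; exact/diagonalP.
split=> [[z /= /IH zx Fyz]|/rel_iterSl[z yz /IH zx]].
  by apply/rel_iterSl; exists z.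
by exists z.
Qed.

Lemma rel_iter_image_sub F n P :
  rel_image F P `<=` P -> rel_image (rel_iter F n) P `<=` P.
Proof.
move=> FP; elim: n => [|n IH] y [x Px]; first by move=> /diagonalP <-.
by move=> [z /= xz zy]; apply: FP; exists z => //; apply: IH; exists x.
Qed.

Lemma rel_iter_image_anti F P m n :
  rel_image F P `<=` P -> (m <= n)%N ->
  rel_image (rel_iter F n) P `<=` rel_image (rel_iter F m) P.
Proof.
move=> FP mn y [x Px]; rewrite -(subnK mn) => /rel_iterD[z xz zy].
by exists z => //; apply: (rel_iter_image_sub (n := n - m) FP); exists x.
Qed.

End Iterates.

(** * Closed relations on compact spaces *)

(** Images, compositions and path spaces are all obtained by quantifying a
    variable away over a compact set, and they are closed for this reason. *)
Lemma closed_compact_projection {T Z : topologicalType}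
    (D : set Z) (E : set (T * Z)) :
  compact D -> closed E -> closed [set x | exists2 z, D z & E (x, z)].
Proof.
move=> /compact_near_coveringP cD cE; rewrite -openC openE => x nx.
have : \forall y \near x, D `<=` [set z | ~ E (y, z)].
  apply: cD => z Dz.
  have : nbhs (x, z) (~` E).
    apply: open_nbhs_nbhs; split; first exact: closed_openC.
    by move=> Exz; apply: nx; exists z.
  move=> [[A B] /= [xA zB] AB].
  by exists (B, A) => //= -[u v] [/= Bu Av]; apply: (AB (v, u)).
by apply: filterS => y Dy [z Dz Eyz]; exact: Dy Dz Eyz.
Qed.

Lemma closed_preimage {S T : topologicalType} (f : S -> T) (A : set T) :
  continuous f -> closed A -> closed (f @^-1` A).
Proof. by move=> /continuous_closedP; apply. Qed.
Arguments closed_preimage {S T} f A.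

Lemma continuous_pair {S T U : topologicalType} (f : S -> T) (g : S -> U) :
  continuous f -> continuous g -> continuous (fun x => (f x, g x)).
Proof. by move=> cf cg x; apply: cvg_pair; [exact: cf | exact: cg]. Qed.

Lemma continuous_fst {S T : topologicalType} : continuous (@fst S T).
Proof. by move=> x; exact: cvg_fst. Qed.

Lemma continuous_snd {S T : topologicalType} : continuous (@snd S T).
Proof. by move=> x; exact: cvg_snd. Qed.

Lemma continuous_compose {S T U : topologicalType} (f : S -> T) (g : T -> U) :
  continuous f -> continuous g -> continuous (fun x => g (f x)).
Proof. by move=> cf cg x; apply: continuous_comp; [exact: cf | exact: cg]. Qed.
Arguments continuous_compose {S T U} f g.

Section CompactSpace.
Context {X : topologicalType} (cptX : compact [set: X]).
Implicit Types (E F : set (X * X)) (A : set X).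

Lemma closed_compose E F :
  closed E -> closed F -> closed (E \; F)%relation.
Proof.
move=> cE cF.
have -> : (E \; F)%relation = [set p | exists2 z, [set: X] z &
    ([set q : X * X * X | F (q.1.1, q.2)] `&`
     [set q : X * X * X | E (q.2, q.1.2)]) (p, z)].
  by apply/seteqP; split=> [] p; [move=> [z ? ?]; exists z|
    move=> [z _ [? ?]]; exists z].
apply: closed_compact_projection => //; apply: closedI.
  apply: (closed_preimage (fun q : X * X * X => (q.1.1, q.2)) F) => //.
  apply: continuous_pair; last exact: continuous_snd.
  by apply: continuous_compose; exact: continuous_fst.
apply: (closed_preimage (fun q : X * X * X => (q.2, q.1.2)) E) => //.
apply: continuous_pair; first exact: continuous_snd.
by apply: continuous_compose; [exact: continuous_fst|exact: continuous_snd].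
Qed.

Lemma closed_rel_image E A : closed E -> closed A -> closed (rel_image E A).
Proof.
move=> cE cA.
have -> : rel_image E A = [set y | exists2 x, A x &
    [set q : X * X | E (q.2, q.1)] (y, x)] by [].
apply: closed_compact_projection; first exact: subclosed_compact cA cptX _.
apply: (closed_preimage (fun q : X * X => (q.2, q.1)) E) => //.
by apply: continuous_pair; [exact: continuous_snd|exact: continuous_fst].
Qed.

Lemma closed_rel_inv E : closed E -> closed E^-1%relation.
Proof.
move=> cE; apply: (closed_preimage (fun q : X * X => (q.2, q.1)) E) => //.
by apply: continuous_pair; [exact: continuous_snd|exact: continuous_fst].
Qed.

Lemma closed_diagonal : hausdorff_space X -> closed (@diagonal X).
Proof.
move=> hX; rewrite -openC openE => -[x y] /= xy.
move: hX; rewrite open_hausdorff => /(_ x y) [|[A B] /=].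
  by apply/eqP => exy; apply: xy; exact/diagonalP.
rewrite !inE => -[Ax By] [oA oB AB].
exists (A, B) => /=; first by split; exact: open_nbhs_nbhs.
move=> [u v] [/= Au Bv] /diagonalP uv.
have : (A `&` B) u by split=> //; rewrite uv.
by rewrite AB.
Qed.

Lemma closed_rel_iter E n : hausdorff_space X -> closed E ->
  closed (rel_iter E n).
Proof.
move=> hX cE; elim: n => [|n IH]; first exact: closed_diagonal.
exact: closed_compose.
Qed.

(** Outside O each point has a neighborhood that misses all late terms of the
    sequence; compactness of the complement makes this uniform. *)
Lemma decreasing_closed_sub_open (D : nat -> set X) (O : set X) :
  (forall n, closed (D n)) -> (forall m n, (m <= n)%N -> D n `<=` D m) ->
  open O -> \bigcap_n D n `<=` O ->
  exists N, forall n, (N <= n)%N -> D n `<=` O.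
Proof.
move=> cD dD oO DO.
have : compact (~` O).
  by apply: subclosed_compact cptX _ => //; exact: open_closedC.
move=> /compact_near_coveringP cO.
have : \forall n \near \oo, ~` O `<=` ~` D n.
  apply: cO => x Ox.
  have [k Dkx] : exists k, ~ D k x.
    by apply/existsNP => Dx; apply: Ox; apply: DO => n _; exact: Dx.
  exists (~` D k, [set n : nat | (k <= n)%N]) => /=.
    split; last by exists k.
    by apply: open_nbhs_nbhs; split => //; exact: closed_openC.
  by move=> [y n] [/= Dy kn] Dny; apply: Dy; exact: dD Dny.
by move=> [N _ NO]; exists N => n /NO nO x Dnx; apply: contrapT => /nO.
Qed.

End CompactSpace.

Lemma closed_open_shrink {R : realType} {X : pseudoMetricType R} (D O : set X) :
  closed D -> open O -> D `<=` O ->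
  exists W : set X, [/\ open W, D `<=` W & closure W `<=` O].
Proof.
move=> cD oO DO.
have [|W DW WO] := @pseudometric_normal R X D cD O.
  by move=> x Dx; apply: open_nbhs_nbhs; split=> //; exact: DO.
exists W°; split; first exact: open_interior.
- exact: DW.
- by apply: subset_trans WO; apply: closureS; exact: interior_subset.
Qed.

(** * Semiflow relations and their restriction to a closed set *)

Section PathRelation.
Context {R : realType} {X : metricType R}.
Implicit Types (Phi : set (X * R * X)) (C : set X).

Lemma semiflow_relation0 Phi x y :
  semiflow_relation Phi -> Phi (x, 0, y) <-> x = y.
Proof.
move=> [_ _ P0 _]; rewrite -[Phi _]/(time_slice Phi 0 (x, y)) P0.
exact: diagonalP.
Qed.

Lemma semiflow_relationD Phi x y z (s t : R) : semiflow_relation Phi ->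
  Phi (x, s, y) -> Phi (y, t, z) -> Phi (x, s + t, z).
Proof.
move=> [_ pos _ PD] xy yz.
rewrite -[Phi _]/(time_slice Phi (s + t) (x, z)) addrC.
by rewrite -PD ?(pos _ _ _ xy) ?(pos _ _ _ yz) //; exists y.
Qed.

Lemma path_relation_time_le Phi (u : R -> X) (t s1 s2 : R) :
  semiflow_relation Phi ->
  (forall s1 s2 : R, 0 <= s1 -> s1 < s2 -> s2 <= t ->
     Phi (u s1, s2 - s1, u s2)) ->
  0 <= s1 -> s1 <= s2 -> s2 <= t -> Phi (u s1, s2 - s1, u s2).
Proof.
move=> sP uP s10; rewrite le_eqVlt => /orP[/eqP <-|s12] s2t; last exact: uP.
by rewrite subrr; apply/semiflow_relation0.
Qed.

Lemma path_relation_cat Phi C x y z (s t : R) : semiflow_relation Phi ->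
  path_relation Phi C (x, s, y) -> path_relation Phi C (y, t, z) ->
  path_relation Phi C (x, s + t, z).
Proof.
move=> sP [Cx s0 Cy [u uC [ux uy uP]]] [_ t0 Cz [v vC [vy vz vP]]].
split=> //; first exact: addr_ge0.
exists (fun r => if r <= s then u r else v (r - s)).
  move=> r /andP[r0 rst]; case: leP => rs; first by apply: uC; rewrite r0.
  by apply: vC; lra.
split; first by rewrite s0.
  case: leP => [h|_]; last by rewrite addrC addKr.
  (* the end time s + t falls in the first piece only when t = 0 *)
  have t00 : t = 0 by lra.
  by rewrite t00 addr0 uy -vy -vz t00.
move=> s1 s2 s10 s12 s2t.
case: (leP s2 s) => s2s.
  by rewrite (le_trans (ltW s12) s2s); exact: uP.
case: (leP s1 s) => s1s.
  rewrite (_ : s2 - s1 = (s - s1) + (s2 - s)); last by lra.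
  apply: (semiflow_relationD (y := y)) => //.
    by rewrite -uy; apply: (path_relation_time_le (u := u) (t := s)).
  rewrite -vy -[X in Phi (_, X, _)]subr0; apply: vP; lra.
rewrite (_ : s2 - s1 = (s2 - s) - (s1 - s)); last by lra.
by apply: vP; lra.
Qed.

Lemma path_relation_split Phi C x z (s t : R) :
  path_relation Phi C (x, t, z) -> 0 <= s <= t ->
  exists2 y, path_relation Phi C (x, s, y) & path_relation Phi C (y, t - s, z).
Proof.
move=> [Cx t0 Cz [u uC [ux uz uP]]] /andP[s0 st]; exists (u s).
  split=> //; first by apply: uC; rewrite s0.
  exists u; first by move=> r /andP[r0 rs]; apply: uC; lra.
  by split=> // s1 s2 s10 s12 s2s; apply: uP => //; lra.
split=> //; [by apply: uC; rewrite s0 | lra |].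
exists (fun r => u (r + s)); first by move=> r /andP[r0 rs]; apply: uC; lra.
split; [by rewrite add0r|by rewrite subrK|].
move=> s1 s2 s10 s12 s2s.
rewrite (_ : s2 - s1 = (s2 + s) - (s1 + s)); last by lra.
by apply: uP; lra.
Qed.

(** Rescaling to the unit interval makes the constraints at two fixed times
    s1 and s2 closed conditions on the duration t and the path together; for
    a path defined on [0, t] the set of admissible times varies with t. *)
Definition unit_path Phi C (x : X) (t : R) (y : X) (u : R -> X) : Prop :=
  [/\ u 0 = x, u 1 = y & forall s1 s2 : R, 0 <= s1 -> s1 <= s2 -> s2 <= 1 ->
     C (u s1) /\ Phi (u s1, (s2 - s1) * t, u s2)].

Lemma path_relation_unit Phi C x (t : R) y : semiflow_relation Phi ->
  path_relation Phi C (x, t, y) <->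
  0 <= t /\ exists u, unit_path Phi C x t y u.
Proof.
move=> sP; split=> [[Cx t0 Cy [u uC [ux uy uP]]]|[t0 [u [ux uy uP]]]].
  split=> //; exists (fun s => u (s * t)); split.
  - by rewrite mul0r.
  - by rewrite mul1r.
  - move=> s1 s2 s10 s12 s21.
    have s1t : 0 <= s1 * t by exact: mulr_ge0.
    have s12t : s1 * t <= s2 * t by exact: ler_wpM2r.
    have s2t : s2 * t <= t by rewrite -[leRHS]mul1r; exact: ler_wpM2r.
    split; first by apply: uC; rewrite s1t (le_trans s12t).
    by rewrite mulrBl; apply: (path_relation_time_le (u := u) (t := t)).
have C01 (s : R) : 0 <= s -> s <= 1 -> C (u s).
  by move=> s0 s1; apply: (uP s s _ _ _).1.
split=> //; [by rewrite -ux; exact: C01|by rewrite -uy; exact: C01|].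
(* a path of duration 0 cannot be recovered by dividing the time by t *)
have [t00|tpos] := eqVneq t 0.
  have xy : x = y.
    apply/(semiflow_relation0 _ _ sP); rewrite -ux -uy.
    by have [] := uP 0 1 (lexx _) ler01 (lexx _); rewrite t00 mulr0.
  exists (fun=> x); first by move=> s _; rewrite -ux; exact: C01.
  by split=> // s1 s2; rewrite t00; lra.
have tgt : 0 < t by rewrite lt_def tpos.
exists (fun s => u (s / t)).
  move=> s /andP[s0 st]; apply: C01; first exact: divr_ge0.
  by rewrite ler_pdivrMr // mul1r.
split; [by rewrite mul0r|by rewrite divff|].
move=> s1 s2 s10 s12 s2t.
have := uP (s1 / t) (s2 / t); rewrite -mulrBl divfK //.
move=> /(_ _ _ _) [] //; first exact: divr_ge0.
- by rewrite ler_pM2r ?invr_gt0 // ltW.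
- by rewrite ler_pdivrMr // mul1r.
Qed.

(** The path relation is the projection, along the space Z of all functions
    from R to X, of the set E of triples with a rescaled path.  Each condition
    in E involves finitely many values of the path, so E is closed for
    pointwise convergence, and Z is compact for that topology. *)
Lemma path_relation_closed Phi C : compact [set: X] ->
  semiflow_relation Phi -> closed C -> closed (path_relation Phi C).
Proof.
move=> cptX sP cC; have [cPhi Ppos _ _] := sP.
pose Z : topologicalType := prod_topology (fun _ : R => X).
have cZ : compact [set: Z].
  have := @tychonoff R (fun=> X) (fun=> setT) (fun=> cptX).
  by congr (compact _); apply/seteqP.
have ev (s : R) : continuous (fun q : X * R * X * Z => q.2 s).
  apply: (continuous_compose snd (fun f : Z => f s)).
    exact: continuous_snd.
  exact: (@proj_continuous R (fun=> X) s).
have c1 : continuous (fun q : X * R * X * Z => q.1.1.1).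
  by do 2 (apply: (continuous_compose _ fst); last exact: continuous_fst);
    exact: continuous_fst.
have ct : continuous (fun q : X * R * X * Z => q.1.1.2).
  apply: (continuous_compose _ snd); last exact: continuous_snd.
  by apply: (continuous_compose _ fst); exact: continuous_fst.
have c2 : continuous (fun q : X * R * X * Z => q.1.2).
  by apply: (continuous_compose _ snd);
    [exact: continuous_fst|exact: continuous_snd].
have cdiag := closed_diagonal (@metric_hausdorff _ X).
pose E : set (X * R * X * Z) :=
  [set q | diagonal (q.2 0, q.1.1.1)] `&` [set q | diagonal (q.2 1, q.1.2)] `&`
  [set q | 0 <= q.1.1.2] `&`
  \bigcap_(s in [set s : R * R | [&& 0 <= s.1, s.1 <= s.2 & s.2 <= 1]])
   ([set q | C (q.2 s.1)] `&`
    [set q | Phi (q.2 s.1, (s.2 - s.1) * q.1.1.2, q.2 s.2)]).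
have -> : path_relation Phi C = [set p | exists2 u, [set: Z] u & E (p, u)].
  apply/seteqP; split=> -[[x t] y].
    move=> /(path_relation_unit _ _ _ _ sP)[t0 [u [ux uy uP]]].
    exists u => //; split; first by split=> //; split; exact/diagonalP.
    by move=> [s1 s2] /= /and3P[h1 h2 h3]; apply: uP.
  move=> [u _ [[[/diagonalP ux /diagonalP uy] t0] uP]].
  apply/path_relation_unit => //; split=> //; exists u; split=> //.
  by move=> s1 s2 h1 h2 h3; apply: (uP (s1, s2)); apply/and3P.
apply: closed_compact_projection => //; apply: closedI; first apply: closedI.
- apply: closedI.
    by apply:
      (closed_preimage (fun q : X * R * X * Z => (q.2 0, q.1.1.1)) diagonal)
      => //; exact: continuous_pair.
  by apply:
    (closed_preimage (fun q : X * R * X * Z => (q.2 1, q.1.2)) diagonal)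
    => //; exact: continuous_pair.
- apply: (closed_preimage (fun q : X * R * X * Z => q.1.1.2) [set t | 0 <= t])
    => //; exact: (@closed_ge R 0).
- apply: closed_bigI => -[s1 s2] /= _; apply: closedI.
    exact: (closed_preimage (fun q : X * R * X * Z => q.2 s1) C).
  apply: (closed_preimage (fun q : X * R * X * Z =>
    (q.2 s1, (s2 - s1) * q.1.1.2, q.2 s2)) Phi) => //.
  apply: continuous_pair => //; apply: continuous_pair => //.
  by move=> q; apply: cvgM; [exact: cvg_cst|exact: ct].
Qed.

(** If x <> y then (x, 0, y) is not in Phi, hence neither are the nearby triples
    (x', t, y'): a pair at a definite distance cannot be joined in too short
    a time.  Compactness of the set of pairs gives a uniform bound. *)
Lemma semiflow_short_time Phi (e : R) : compact [set: X] ->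
  semiflow_relation Phi -> 0 < e ->
  exists2 d : R, 0 < d &
    forall x t y, t < d -> Phi (x, t, y) -> ball x e y.
Proof.
move=> cptX sP e0; have [cPhi Ppos _ _] := sP.
have := compact_setX cptX cptX; rewrite setXTT.
move=> /compact_near_coveringP cXX.
have : \forall t \near (0 : R), [set: X * X] `<=`
    [set p : X * X | Phi (p.1, t, p.2) -> ball p.1 e p.2].
  apply: (cXX R (nbhs (0 : R))
    (fun t p => Phi (p.1, t, p.2) -> ball p.1 e p.2)) => -[x y] _.
  have [<-|/eqP xy] := eqVneq x y.
    exists (ball x (e / 2) `*` ball x (e / 2), setT) => /=.
      split; last exact: filterT.
      exists (ball x (e / 2), ball x (e / 2)) => //=.
      by split; apply: nbhsx_ballx; rewrite divr_gt0.
    move=> [[a b] t] [[/= xa xb] _] _.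
    by apply: (ball_splitr xa xb).
  have : nbhs (x, 0 : R, y) (~` Phi).
    apply: open_nbhs_nbhs; split; first exact: closed_openC.
    by move/semiflow_relation0 => /(_ sP).
  move=> [[AB D] /= [[[A B] /= [xA tB] AB'] yD] ABD].
  exists (A `*` D, B) => /=; first by split=> //; exists (A, D).
  move=> [[a b] t] [[/= Aa Db] Bt] Pab; exfalso.
  by apply: (ABD (a, t, b)) => //; split=> //=; apply: (AB' (a, t)).
move=> [d /= d0 dP]; exists d => // x t y td Pxy.
apply: (dP t _ (x, y) I Pxy) => /=.
by rewrite sub0r normrN ger0_norm // (Ppos _ _ _ Pxy).
Qed.

End PathRelation.

(** * The associated relation and + invariant sets *)

Section HybridRelations.
Context {R : realType} {X : metricType R}.
Implicit Types (H : hybrid_data X) (N P : set X).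

Lemma flow_between_id H x : flow_between H 0 1 (x, x).
Proof. by exists 0; [rewrite lexx ler01 | right; exists x]. Qed.

Lemma flow_between_path H (a b t : R) x y : a <= t <= b ->
  path_relation (semiflow H) (flow_set H) (x, t, y) ->
  flow_between H a b (x, y).
Proof. by move=> tab p; exists t => //; left. Qed.

Lemma flow_between_cat H (a b c d : R) x y z :
  semiflow_relation (semiflow H) ->
  flow_between H a b (x, y) -> flow_between H c d (y, z) ->
  flow_between H (a + c) (b + d) (x, z).
Proof.
move=> sP [s sab xy] [t tcd yz]; exists (s + t); first by lra.
case: xy => [xy|[w _ /= [<- <- wy]]]; last by rewrite add0r wy.
case: yz => [yz|[w _ /= [wy <- <-]]]; last by rewrite addr0 wy; left.
by left; exact: path_relation_cat xy yz.
Qed.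

Lemma flow_between_case H (a b c : R) x y : flow_between H a c (x, y) ->
  flow_between H a b (x, y) \/ flow_between H b c (x, y).
Proof.
move=> [t /andP[at_ tc] p]; case: (leP t b) => tb; [left|right]; exists t => //.
  by rewrite at_.
by rewrite ltW.
Qed.

Lemma flow_between_1_3 H x y : flow_between H 1 3 (x, y) ->
  flow_between H 1 2 (x, y) \/
  exists2 z, flow_between H 1 2 (x, z) & flow_between H 1 2 (z, y).
Proof.
move=> /(flow_between_case 2)[|[t t23 p]]; [by left|right].
case: p => [p|[w _ /= [_ t0 _]]]; last by lra.
have [|z xz zy] := path_relation_split (s := 1) p; first by lra.
by exists z; [exists 1; [lra|left]|exists (t - 1); [lra|left]].
Qed.

Lemma flow_between_closed H (a b : R) : compact [set: X] ->
  semiflow_relation (semiflow H) -> closed (flow_set H) ->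
  closed (flow_between H a b).
Proof.
move=> cptX sP cC.
pose E : set (X * R * X) := path_relation (semiflow H) (flow_set H) `|`
  range (fun z => (z, 0, z)).
have cE : closed E.
  apply: closedU; first exact: path_relation_closed.
  have -> : range (fun z : X => (z, 0 : R, z)) =
      [set p : X * R * X | diagonal (p.1.1, p.2)] `&`
      [set p : X * R * X | p.1.2 <= 0] `&` [set p : X * R * X | 0 <= p.1.2].
    apply/seteqP; split=> [_ [z _ <-]|[[x t] y] [[/diagonalP /= <- t1] t2]].
      by split; [split|]; rewrite /= ?lexx.
    by exists x => //; congr (_, _, _); apply: le_anti; rewrite t2.
  have c1 : continuous (fun p : X * R * X => p.1.2).
    by apply: (continuous_compose fst snd);
      [exact: continuous_fst|exact: continuous_snd].
  apply: closedI; first apply: closedI.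
  - apply: (closed_preimage (fun p : X * R * X => (p.1.1, p.2)) diagonal).
      apply: continuous_pair; last exact: continuous_snd.
      by apply: (continuous_compose fst fst); exact: continuous_fst.
    exact: closed_diagonal (@metric_hausdorff _ X).
  - by apply: (closed_preimage _ [set t : R | t <= 0]) => //;
      exact: (@closed_le R 0).
  - by apply: (closed_preimage _ [set t : R | 0 <= t]) => //;
      exact: (@closed_ge R 0).
have -> : flow_between H a b =
    [set xy | exists2 t, [set` `[a, b]] t &
      [set p : X * X * R | E (p.1.1, p.2, p.1.2)] (xy, t)].
  by apply/seteqP; split=> [] xy [t tab p]; exists t => //;
    move: tab; rewrite /= in_itv.
apply: closed_compact_projection; first exact: segment_compact.
apply: (closed_preimage (fun p : X * X * R => (p.1.1, p.2, p.1.2)) E) => //.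
apply: continuous_pair; first apply: continuous_pair.
- by apply: (continuous_compose fst fst); exact: continuous_fst.
- exact: continuous_snd.
- by apply: (continuous_compose fst snd);
    [exact: continuous_fst|exact: continuous_snd].
Qed.

Lemma associated_relation_closed H : compact [set: X] ->
  semiflow_relation (semiflow H) -> closed (flow_set H) -> closed (jump H) ->
  closed (associated_relation H).
Proof.
move=> cptX sP cC cG.
have cF a b : closed (flow_between H a b) by exact: flow_between_closed.
rewrite /associated_relation; apply: closedU => //.
by apply: closed_compose => //; exact: closed_compose.
Qed.

Lemma jump_associated H x y : jump H (x, y) -> associated_relation H (x, y).
Proof.
move=> Gxy; left; exists x; first exact: flow_between_id.
by exists y => //; exact: flow_between_id.
Qed.

(** The time windows [0,1] and [1,2] of the associated relation are what makes
    it absorb a short flow: a flow of duration at most 2 splits as a flow in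
    [0,1] or a step, and one of duration in [1,3] splits as one or two steps. *)
Lemma flow_then_step H x y z : semiflow_relation (semiflow H) ->
  flow_between H 0 1 (x, y) -> associated_relation H (y, z) ->
  exists k, (k <= 1)%N /\ rel_iter (associated_relation H) k.+1 (x, z).
Proof.
move=> sP xy [[a ya [b Gab bz]]|yz].
  have xa := flow_between_cat sP xy ya.
  rewrite !addr0 in xa.
  have [xa1|xa1] := flow_between_case 1 xa.
    by exists 0%N; split=> //; apply/rel_iter1; left; exists a => //; exists b.
  exists 1%N; split=> //; apply/rel_iterSl; exists a; first by right.
  by apply/rel_iter1; left; exists a; [exact: flow_between_id | exists b].
have xz := flow_between_cat sP xy yz.
rewrite add0r (_ : 1 + 2 = 3) in xz; last by lra.
have [xz1|[w xw wz]] := flow_between_1_3 xz.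
  by exists 0%N; split=> //; apply/rel_iter1; right.
exists 1%N; split=> //; apply/rel_iterSl; exists w; first by right.
by apply/rel_iter1; right.
Qed.

Lemma step_then_flow H x y z : semiflow_relation (semiflow H) ->
  associated_relation H (x, y) -> flow_between H 0 1 (y, z) ->
  exists k, (k <= 1)%N /\ rel_iter (associated_relation H) k.+1 (x, z).
Proof.
move=> sP [[a xa [b Gab bz]]|xy] yz.
  have bz' := flow_between_cat sP bz yz.
  rewrite !addr0 in bz'.
  have [bz1|bz1] := flow_between_case 1 bz'.
    by exists 0%N; split=> //; apply/rel_iter1; left; exists a => //; exists b.
  exists 1%N; split=> //; apply/rel_iterSl; exists b.
    by left; exists a => //; exists b => //; exact: flow_between_id.
  by apply/rel_iter1; right.
have xz := flow_between_cat sP xy yz.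
rewrite addr0 (_ : 2 + 1 = 3) in xz; last by lra.
have [xz1|[w xw wz]] := flow_between_1_3 xz.
  by exists 0%N; split=> //; apply/rel_iter1; right.
exists 1%N; split=> //; apply/rel_iterSl; exists w; first by right.
by apply/rel_iter1; right.
Qed.

Lemma flow_then_iter H n x y z : semiflow_relation (semiflow H) ->
  flow_between H 0 1 (x, y) -> rel_iter (associated_relation H) n.+1 (y, z) ->
  exists k, (n <= k)%N /\ rel_iter (associated_relation H) k.+1 (x, z).
Proof.
move=> sP xy /rel_iterSl[w yw wz].
have [k [_ xw]] := flow_then_step sP xy yw.
exists (k + n)%N; split; first exact: leq_addl.
by rewrite -addSn; apply/rel_iterD; exists w.
Qed.

Lemma iter_then_flow H n x y z : semiflow_relation (semiflow H) ->
  rel_iter (associated_relation H) n.+1 (x, y) -> flow_between H 0 1 (y, z) ->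
  exists k, (n <= k)%N /\ rel_iter (associated_relation H) k.+1 (x, z).
Proof.
move=> sP [w xw wy] yz.
have [k [_ wz]] := step_then_flow sP wy yz.
have : rel_iter (associated_relation H) (n + k.+1) (x, z).
  by apply/rel_iterD; exists w.
by rewrite addnS => xz; exists (n + k)%N; split=> //; exact: leq_addr.
Qed.

Lemma plus_invariant_flow H P (b : R) : plus_invariant H P ->
  forall a, rel_image (flow_between H a b) P `<=` P.
Proof.
move=> [_ fP] a y [x Px [t _ [p|[w _ /= [wx _ <-]]]]]; first exact: fP Px p.
by rewrite wx.
Qed.

Lemma plus_invariant_associated H P : plus_invariant H P ->
  rel_image (associated_relation H) P `<=` P.
Proof.
move=> iP; have [gP _] := iP.
have fP a b u v : P u -> flow_between H a b (u, v) -> P v.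
  by move=> Pu uv; apply: (plus_invariant_flow iP (a := a) (b := b)); exists u.
move=> y [x Px [[a xa [b Gab bz]]|xy]]; last exact: fP Px xy.
by apply: (fP _ _ _ _ _ bz); apply: gP; exists a => //; exact: fP Px xa.
Qed.

(** A flow of any duration is a succession of flows of duration at most 1. *)
Lemma plus_invariantP H P :
  rel_image (jump H) P `<=` P -> rel_image (flow_between H 0 1) P `<=` P ->
  plus_invariant H P.
Proof.
move=> gP fP; split=> // x t y Px p.
have [n tn] : exists n : nat, t <= n%:R.
  by exists (Num.bound t); apply/ltW/archi_boundP; case: p.
elim: n t x Px p tn => [|n IH] t x Px p tn; have t0 : 0 <= t by case: p.
  by apply: fP; exists x => //; apply: flow_between_path p; lra.
case: (leP t 1) => t1.
  by apply: fP; exists x => //; apply: flow_between_path p; rewrite t0.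
have [|z xz zy] := path_relation_split (s := 1) p; first by lra.
apply: (IH _ _ _ zy); last by rewrite -natr1 in tn; lra.
by apply: fP; exists x => //; apply: flow_between_path xz; rewrite lexx ler01.
Qed.

Lemma plus_invariant_bigcap H (D : set nat) (P : nat -> set X) :
  (forall k, D k -> plus_invariant H (P k)) ->
  plus_invariant H (\bigcap_(k in D) P k).
Proof.
move=> iP; split=> [y [x Px xy] k Dk|x t y Px xy k Dk].
  by apply: (iP k Dk).1; exists x => //; exact: Px.
by apply: (iP k Dk).2 xy; exact: Px.
Qed.

Lemma plus_invariantU H P Q : plus_invariant H P -> plus_invariant H Q ->
  plus_invariant H (P `|` Q).
Proof.
move=> [gP fP] [gQ fQ]; split=> [y [x [Px|Qx] xy]|x t y [Px|Qx] xy].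
- by left; apply: gP; exists x.
- by right; apply: gQ; exists x.
- by left; exact: fP xy.
- by right; exact: fQ xy.
Qed.

(** The endpoints of the solution paths that start in N: a path without jump
    shorter than 1 is a single flow, any other is a chain of steps.  Without the
    initial short flow the set would not be stable under flows shorter
    than 1. *)
Definition reach H N : set X :=
  \bigcup_k rel_image (rel_iter (associated_relation H) k)
              (rel_image (flow_between H 0 1) N).

Lemma sub_flow_image H N : N `<=` rel_image (flow_between H 0 1) N.
Proof. by move=> x Nx; exists x => //; exact: flow_between_id. Qed.

Lemma sub_reach H N : N `<=` reach H N.
Proof.
move=> x Nx; exists 0%N => //; exists x; first exact: sub_flow_image.
exact/diagonalP.
Qed.

Lemma reach_plus_invariant H N : semiflow_relation (semiflow H) ->
  plus_invariant H (reach H N).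
Proof.
move=> sP; apply: plus_invariantP.
  move=> z [y [k _ [x Nx xy]] yz]; exists k.+1 => //; exists x => //.
  by exists y => //; exact: jump_associated.
move=> z [y [[|k] _ [x Nx xy]] yz].
  have [w Nw wx] := Nx; rewrite -(proj1 (diagonalP _ _) xy) in yz.
  have wz := flow_between_cat sP wx yz.
  rewrite addr0 in wz.
  have [wz1|wz1] := flow_between_case 1 wz.
    by exists 0%N => //; exists z; [exists w | exact/diagonalP].
  exists 1%N => //; exists w; first exact: sub_flow_image.
  by apply/rel_iter1; right.
have [m [_ xz]] := iter_then_flow sP xy yz.
by exists m.+1 => //; exists x.
Qed.

Lemma reach_sub H N P : plus_invariant H P -> N `<=` P -> reach H N `<=` P.
Proof.
move=> iP NP y [k _ [x [w Nw wx] xy]].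
apply: (rel_iter_image_sub (n := k) (plus_invariant_associated iP)).
exists x => //; apply: (plus_invariant_flow iP); exists w; last exact: wx.
exact: NP.
Qed.

(** Infinite unions of closed sets need not be closed; here Q swallows all but
    finitely many terms of the union that defines [reach H N]. *)
Lemma reach_closed H N Q n : compact [set: X] ->
  semiflow_relation (semiflow H) -> closed (flow_set H) -> closed (jump H) ->
  closed N -> closed Q ->
  (forall k, (n <= k)%N ->
    rel_image (rel_iter (associated_relation H) k)
      (rel_image (flow_between H 0 1) N) `<=` Q) ->
  closed (reach H N `|` Q).
Proof.
move=> cptX sP cC cG cN cQ NQ.
have -> : reach H N `|` Q = (\bigcup_(k in `I_n)
    rel_image (rel_iter (associated_relation H) k)
      (rel_image (flow_between H 0 1) N)) `|` Q.
  apply/seteqP; split=> y [[k _ xy]|Qy]; try by right.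
    by case: (ltnP k n) => kn; [left; exists k|right; exact: NQ kn _ xy].
  by left; exists k.
apply: closedU => //; apply: closed_bigcup; first exact: finite_II.
move=> k _; apply: closed_rel_image => //.
  apply: closed_rel_iter => //; first exact: metric_hausdorff.
  exact: associated_relation_closed.
by apply: closed_rel_image => //; exact: flow_between_closed.
Qed.

(** A path of duration at most e that ends near x, where the ball of radius r
    around x lies in K, stays in that ball, so it is a path of the restriction
    to K and cannot leave P.  The bound e depends on r only, not on x or P,
    which gives one exit time valid along a compact set of points x. *)
Lemma local_exit H K (r : R) : compact [set: X] ->
  semiflow_relation (semiflow H) -> 0 < r ->
  exists2 e : R, 0 < e & forall P x, plus_invariant (restriction H K) P ->
    P `<=` K -> ball x r `<=` K ->
    ~ closure (rel_image (flow_between H 0 e) P `\` P) x.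
Proof.
move=> cptX sP r0.
have [|d d0 dP] := semiflow_short_time (e := r / 2) cptX sP; first by lra.
exists (d / 2) => [|P x [_ fP] PK xK clx]; first by lra.
have [|y [[[p Pp [t td py]] nPy] xy]] := clx (ball x (r / 2)).
  by apply: nbhsx_ballx; lra.
case: py => [[Cp t0 Cy [u uC [up uy uP]]]|[w _ /= [ep _ ey]]]; last first.
  by apply: nPy; rewrite -ey ep.
have uty : u t = y := uy.
have uK s : 0 <= s <= t -> K (u s).
  move=> /andP[s0 st]; apply: xK; apply: (ball_splitl xy).
  apply: (dP _ (t - s)); first by lra.
  by rewrite -uty; exact: (path_relation_time_le (u := u) (t := t)).
apply: nPy; apply: (fP p t y Pp); split=> //=.
- by split=> //; exact: PK.
- by split=> //; rewrite -uty; apply: uK; rewrite t0 lexx.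
by exists u => // s st; split; [exact: uC|exact: uK].
Qed.

Lemma compact_ball_margin (D O : set X) : compact D -> D `<=` O° ->
  exists2 r : R, 0 < r & forall x, D x -> ball x r `<=` O.
Proof.
move=> /compact_near_coveringP cD DO.
have : \forall r \near (0 : R)^'+, D `<=` [set x | ball x r `<=` O].
  apply: cD => x /DO; rewrite /interior /= -nbhs_ballE => -[r /= r0 xO].
  exists (ball x (r / 2), [set s | s < r / 2]) => /=.
    split; first by apply: nbhsx_ballx; lra.
    by apply: nbhs_right_lt; lra.
  move=> [y s] [/= xy sr] z yz; apply: xO; apply: (ball_split xy).
  exact: le_ball (ltW sr) _ yz.
move=> DO'; have : \forall r \near (0 : R)^'+, 0 < r /\
    D `<=` [set x | ball x r `<=` O].
  by near=> r; split=> //; near: r.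
by move=> /filter_ex[r [r0 rO]]; exists r.
Unshelve. all: by end_near. Qed.

End HybridRelations.

(** * Index pairs of an isolated set *)

Section Isolated.
Context {R : realType} {X : metricType R} (cptX : compact [set: X]).
Context {H : hybrid_data X} (hH : hybrid_system H).
Context {K : set X} (cK : closed K).

Let HK := restriction H K.
Let F := associated_relation HK.
Let fwd n := rel_image (rel_iter F n) K.
Let bwd n := rel_image (rel_iter F^-1%relation n) K.

Lemma restricted_step x y : F (x, y) -> K x /\ K y.
Proof.
have fK b u v : flow_between HK 0 b (u, v) -> K u <-> K v.
  move=> [t _ [[/= [_ Ku] _ [_ Kv] _]|[w _ /= [wu _ wv]]]]; first by split.
  by rewrite -wu wv.
move=> [[a xa [b [_ /= [Ka Kb]] bz]]|[t t12 [[/= [_ Kx] _ [_ Ky] _] //|]]].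
  by split; [exact/(fK _ _ _ xa)|exact/(fK _ _ _ bz)].
by move=> [w _ /= [_ t0 _]]; lra.
Qed.

Lemma ambient_plus_invariant : plus_invariant HK K.
Proof. by split=> [y [x _ [_ [_ ?]]]|x t y _ [_ _ [_ ?] _]]. Qed.

Let sP : semiflow_relation (semiflow HK).
Proof. by have [] := hH. Qed.

Let cC : closed (flow_set HK).
Proof. by have [_ _ ? _] := hH; exact: closedI. Qed.

Let cG : closed (jump HK).
Proof.
have [_ _ _ ?] := hH; apply: closedI => //.
have -> : K `*` K = [set p | K p.1] `&` [set p | K p.2] by [].
apply: closedI; first by apply: closed_preimage => //; exact: continuous_fst.
by apply: closed_preimage => //; exact: continuous_snd.
Qed.

Let cF : closed F.
Proof. exact: associated_relation_closed. Qed.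

Let fwd_closed n : closed (fwd n).
Proof.
apply: closed_rel_image => //; apply: closed_rel_iter => //.
exact: metric_hausdorff.
Qed.

Let bwd_closed n : closed (bwd n).
Proof.
apply: closed_rel_image => //; apply: closed_rel_iter => //.
  exact: metric_hausdorff.
exact: closed_rel_inv.
Qed.

Let fwd_anti m n : (m <= n)%N -> fwd n `<=` fwd m.
Proof.
by apply: rel_iter_image_anti => y [x _ /restricted_step[]].
Qed.

Let bwd_anti m n : (m <= n)%N -> bwd n `<=` bwd m.
Proof.
by apply: rel_iter_image_anti => y [x _ /restricted_step[]].
Qed.

Lemma bwdP n x : bwd n x <-> exists2 y, K y & rel_iter F n (x, y).
Proof. by split=> -[y Ky xy]; exists y => //; apply/rel_iter_inv. Qed.

Lemma backward_part_closed : closed (backward_part H K).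
Proof. by apply: closed_bigI => n _; exact: fwd_closed. Qed.

Lemma forward_part_closed : closed (forward_part H K).
Proof. by apply: closed_bigI => n _; exact: bwd_closed. Qed.

Lemma backward_part_sub : backward_part H K `<=` K.
Proof. by move=> x /(_ 1%N isT)[z _ /rel_iter1 /restricted_step[]]. Qed.

Lemma forward_part_sub : forward_part H K `<=` K.
Proof. by move=> x /(_ 1%N isT)[z _ /rel_iter1 /restricted_step[]]. Qed.

Lemma fwd_sub_open (O : set X) : open O -> backward_part H K `<=` O ->
  exists N, forall n, (N <= n)%N -> fwd n `<=` O.
Proof.
move=> oO KO; apply: decreasing_closed_sub_open => // x xD.
by apply: KO => n _; exact: xD.
Qed.

Lemma bwd_sub_open (O : set X) : open O -> forward_part H K `<=` O ->
  exists N, forall n, (N <= n)%N -> bwd n `<=` O.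
Proof.
move=> oO KO; apply: decreasing_closed_sub_open => // x xD.
by apply: KO => n _; exact: xD.
Qed.

Lemma viable_sub_open (O : set X) : open O -> viable_part H K `<=` O ->
  exists N, forall n, (N <= n)%N -> fwd n `&` bwd n `<=` O.
Proof.
move=> oO KO.
apply: (decreasing_closed_sub_open cptX (D := fun n => fwd n `&` bwd n)) => //.
- by move=> n; exact: closedI.
- by move=> m n mn x [/(fwd_anti mn) ? /(bwd_anti mn)].
- by move=> x xD; apply: KO; split=> n _; have [] := xD n I.
Qed.

(** After n.+1 steps a further jump is one more step, and a further flow is
    absorbed into at least n.+1 steps; both stay in the decreasing sequence. *)
Lemma fwd_plus_invariant n : plus_invariant HK (fwd n.+1).
Proof.
apply: plus_invariantP => z [y [x Kx xy] yz].
  apply: (@fwd_anti n.+1 n.+2) => //; exists x => //.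
  by exists y => //; exact: jump_associated.
have [k [nk xz]] := iter_then_flow sP xy yz.
by apply: (@fwd_anti n.+1 k.+1) => //; exists x.
Qed.

Lemma backward_part_plus_invariant : plus_invariant HK (backward_part H K).
Proof.
by apply: plus_invariant_bigcap => -[//|n] _; exact: fwd_plus_invariant.
Qed.

(** If x reaches a point of K_+, the infinite forward path of that point can be
    prolonged backward to x. *)
Lemma forward_part_reach x : forward_part H K `&` reach HK [set x] !=set0 ->
  forward_part H K x.
Proof.
move=> [y [Ky [k _ [w [_ -> xw] wy]]]] [//|j] j1.
have /bwdP[z Kz yz] := Ky j.+1 j1.
have wz : rel_iter F (k + j).+1 (w, z).
  by rewrite -addnS; apply/rel_iterD; exists y.
have [i [kji xz]] := flow_then_iter sP xw wz.
apply: (@bwd_anti j.+1 i.+1); last by apply/bwdP; exists z.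
by rewrite ltnS (leq_trans _ kji) // leq_addl.
Qed.

(** The midpoint of a chain of length 2n that ends at y starts and ends chains
    of length n in K, hence is close to A when n is large. *)
Lemma index_pair_backward A P1 P2 : index_pair H K A P1 P2 ->
  backward_part H K `<=` P1.
Proof.
move=> [_ _ [iP1 _] [-> AP] _] y Ky.
have [|n nP] := viable_sub_open (open_interior P1).
  by move=> x /AP[].
have Kyy := backward_part_sub Ky.
have [x Kx /rel_iterD[z xz zy]] := Ky (n.+1 + n.+1)%N isT.
have P1z : P1 z.
  apply: interior_subset; apply: (nP n.+1) => //; split; first by exists x.
  by apply/bwdP; exists y.
apply: (rel_iter_image_sub (n := n.+1) (plus_invariant_associated iP1)).
by exists z.
Qed.

(** Same midpoints, for chains that start in P2; + invariance keeps them in P2,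
    at a positive distance from A. *)
Lemma index_pair_forward A P1 P2 : index_pair H K A P1 P2 ->
  forward_part H K `&` P2 = set0.
Proof.
move=> [[_ cP2] _ [_ iP2] [-> AP] _]; apply/seteqP; split=> // x [Kx P2x].
have [|n nP] := viable_sub_open (closed_openC cP2).
  by move=> a /AP[].
have Kxx := forward_part_sub Kx.
have /bwdP[y Ky /rel_iterD[z xz zy]] := Kx (n.+1 + n.+1)%N isT.
apply: (nP n.+1 _ z) => //.
  by split; [exists x|apply/bwdP; exists y].
apply: (rel_iter_image_sub (n := n.+1) (plus_invariant_associated iP2)).
by exists x.
Qed.

Lemma hybrid_delta_boundary P : plus_invariant HK P -> P `<=` K ->
  hybrid_delta H P `<=` P `&` (K `\` K°).
Proof.
move=> iP PK x.
have sPH : semiflow_relation (semiflow H) by [].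
move=> [[Px clx]|dx].
  split=> //; split; first exact: PK.
  move=> /clx[y [[[p Pp py] nPy] Ky]]; apply: nPy; apply: (iP.1).
  by exists p => //; split=> //; split; [exact: PK|].
have Px : P x by have [] := dx 1 ltr01.
split=> //; split; first exact: PK.
rewrite /interior /= -nbhs_ballE => -[r /= r0 xK].
have [e e0 eP] := local_exit K cptX sPH r0.
by have [_] := dx e e0; exact: eP.
Qed.

Lemma index_pair_exit P1 P2 : P1 `<=` K -> plus_invariant HK P1 ->
  closure (P1 `\` P2) `<=` K° ->
  exists2 e : R, 0 < e & rel_delta (flow_between H 0 e) P1 `<=` P2.
Proof.
move=> P1K iP1 PK.
have [|r r0 rP] := compact_ball_margin _ PK.
  by apply: subclosed_compact cptX _ => //; exact: closed_closure.
have sPH : semiflow_relation (semiflow H) by [].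
have [e e0 eP] := local_exit K cptX sPH r0.
exists e => // x [P1x clx]; apply: contrapT => nP2x.
by apply: (eP P1 x iP1 P1K _ clx); apply: rP; exact: subset_closure.
Qed.

(** P is [reach N] together with [F^n(K)], for n with [F^n(K)] in U and N a
    small neighborhood of K_-.  Adding [F^n(K)] makes P closed, since it
    contains all chains of at least n steps.  The shorter chains from N stay
    in U because those from K_- do: only finitely many closed relations are
    involved, so the set [bad] of starting points that may leave U is closed
    and misses K_-.  Conversely [F^n(K)] alone would not do, as it need not be
    a neighborhood of K_-. *)
Lemma backward_neighborhood (U : set X) : open U -> backward_part H K `<=` U ->
  exists P W : set X, [/\ closed P, plus_invariant HK P, P `<=` K `&` U &
    [/\ open W, backward_part H K `<=` W & W `&` K `<=` P]].
Proof.
move=> oU KU.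
have [n nU] := fwd_sub_open oU KU.
pose bad := \bigcup_(k in `I_n.+1)
  rel_image (rel_iter F k \; flow_between HK 0 1)^-1%relation (~` U).
have cbad : closed bad.
  apply: closed_bigcup => [|k _]; first exact: finite_II.
  apply: closed_rel_image => //; last exact: open_closedC.
  apply: closed_rel_inv; apply: closed_compose => //.
    by apply: closed_rel_iter => //; exact: metric_hausdorff.
  exact: flow_between_closed.
have Kbad : backward_part H K `<=` ~` bad.
  move=> x Kx [k _ [y Uy [w xw wy]]]; apply: Uy; apply: KU.
  apply: (reach_sub backward_part_plus_invariant (fun _ => id)).
  by exists k => //; exists w => //; exists x.
have [W [oW KW Wbad]] := closed_open_shrink backward_part_closed
  (closed_openC cbad) Kbad.
pose N := closure W `&` K.
have NK : N `<=` K by move=> x [].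
have late k : (n.+1 <= k)%N ->
    rel_image (rel_iter F k) (rel_image (flow_between HK 0 1) N) `<=` fwd n.+1.
  move=> nk y [w Nw wy]; apply: (fwd_anti nk); exists w => //.
  have [x Nx xw] := Nw.
  by apply: (reach_sub ambient_plus_invariant NK); exists 0%N => //;
    exists w => //; exact/diagonalP.
exists (reach HK N `|` fwd n.+1), W; split.
- apply: (reach_closed (n := n.+1)) => //.
  by apply: closedI => //; exact: closed_closure.
- apply: plus_invariantU; first exact: reach_plus_invariant.
  exact: fwd_plus_invariant.
- move=> y [Ny|ny]; last first.
    split; last exact: nU ny.
    by case: ny => x _ [w _ /restricted_step[]].
  split; first exact: reach_sub ambient_plus_invariant NK _ Ny.
  have [k _ ky] := Ny; case: (ltnP k n.+1) => kn; last first.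
    by apply: (nU n.+1) => //; exact: late kn _ ky.
  apply: contrapT => Uy; have [w [x [Wx _] xw] wy] := ky.
  by apply: (Wbad x Wx); exists k => //; exists y => //; exists w.
- split=> // x [Wx Kx]; left; apply: sub_reach; split=> //.
  exact: subset_closure.
Qed.

(** The compact set Q misses [F^-n(K)] for some n, so no chain of n or more
    steps starts in Q. *)
Lemma reach_closed_off_forward (Q : set X) : closed Q ->
  Q `&` forward_part H K = set0 -> closed (reach HK Q).
Proof.
move=> cQ QK0.
have [|n nQ] := bwd_sub_open (closed_openC cQ).
  by move=> x Kx Qx; rewrite -[False]/(set0 x) -QK0.
rewrite -[reach HK Q]setU0.
apply: (reach_closed (n := n.+1)) => //; first exact: closed0.
move=> [//|k] nk y [w [x Qx xw] wy].
have Ky : K y by case: wy => ? _ /restricted_step[].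
have [i [ki xy]] := flow_then_iter sP xw wy.
apply: (nQ i.+1 _ x) Qx; last by apply/bwdP; exists y.
by rewrite ltnW // ltnS (leq_trans _ ki).
Qed.

Lemma index_pair_exists A U V : A `<=` K° -> A = viable_part H K ->
  open U -> open V -> backward_part H K `<=` U ->
  viable_part H K `<=` V -> V `<=` K ->
  exists P1 P2 : set X,
    [/\ index_pair H K A P1 P2, P1 `<=` U & closure (P1 `\` P2) `<=` V].
Proof.
move=> AK eA oU oV KU AV VK.
have cA : closed (viable_part H K).
  by apply: closedI; [exact: backward_part_closed|exact: forward_part_closed].
(* shrinking V leaves room for the closure of P1 minus P2 inside V *)
have [V' [oV' AV' V'V]] := closed_open_shrink cA oV AV.
(* off V', the set P1 must miss K_+, so that P2 can contain that part *)
have oU' : open (U `&` (V' `|` ~` forward_part H K)).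
  apply: openI => //; apply: openU => //; apply: closed_openC.
  exact: forward_part_closed.
have [|P1 [W [cP1 iP1 P1K [oW KW WP1]]]] := backward_neighborhood oU'.
  move=> x Kx; split; first exact: KU.
  by case: (pselect (forward_part H K x)) => xF; [left; apply: AV'|right].
pose Q := P1 `\` V'.
have Q0 : Q `&` forward_part H K = set0.
  by apply/seteqP; split=> // x [[/P1K[_ [_ []]]]].
have PQV : P1 `\` reach HK Q `<=` V'.
  move=> x [P1x Qx]; apply: contrapT => V'x.
  by apply: Qx; apply: sub_reach.
have PV : closure (P1 `\` reach HK Q) `<=` V.
  exact: subset_trans (closureS PQV) V'V.
exists P1, (reach HK Q); split=> //; last by move=> x /P1K[_ []].
split.
- split=> //; apply: reach_closed_off_forward => //.
  by apply: closedI => //; exact: open_closedC.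
- by split; [apply: reach_sub => // x []|move=> x /P1K[]].
- by split=> //; exact: reach_plus_invariant.
- split=> // x Ax; split.
    have : (W `&` K°) x.
      by split; [apply: KW; move: Ax; rewrite eA => -[]|exact: AK].
    rewrite -[W](proj1 (interior_id _)) // -interiorI.
    by apply: interiorS; exact: WP1.
  move: Ax; rewrite eA => -[_ xF] [k kT [w [q Qq qw] wx]].
  have : (Q `&` forward_part H K) q.
    split=> //; apply: forward_part_reach; exists x; split=> //.
    by exists k => //; exists w => //; exists q.
  by rewrite Q0.
- have VKo : V `<=` K° by rewrite -open_subsetE.
  by move=> x /subset_closure /PV /VKo.
Qed.

End Isolated.

Unset Implicit Arguments.
Set Strict Implicit.

Theorem theorem4p19 (R : realType) (X : metricType R)
    (cptX : compact [set: X])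
    (H : hybrid_data X) (hH : hybrid_system H)
    (K A : set X) (hK : isolating_neighborhood H K A) :
  (forall P1 P2 : set X, index_pair H K A P1 P2 ->
    [/\ backward_part H K `<=` P1,
        forward_part H K `&` P2 = set0,
        hybrid_delta H P1 `<=` P1 `&` (K `\` K°),
        P1 `&` (K `\` K°) `<=` P2
      & closure (P1 `\` P2) `<=` K° ->
          exists2 e : R, 0 < e & rel_delta (flow_between H 0 e) P1 `<=` P2]) /\
  (forall U V : set X, open U -> open V ->
    backward_part H K `<=` U -> viable_part H K `<=` V -> V `<=` K ->
    exists P1 P2 : set X,
      [/\ index_pair H K A P1 P2, P1 `<=` U,
          closure (P1 `\` P2) `<=` V & closure (P1 `\` P2) `<=` K°]).
Proof.
have [cK eA AK] := hK; split=> [P1 P2 iP|U V oU oV KU AV VK].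
  have [_ [_ P1K] [iP1 _] _ P12K] := iP; split.
  - exact: (index_pair_backward cptX hH cK iP).
  - exact: (index_pair_forward cptX hH cK iP).
  - exact: (hybrid_delta_boundary cptX hH).
  - move=> x [P1x [_ nKx]]; apply: contrapT => P2x.
    by apply: nKx; exact: P12K.
  - exact: (index_pair_exit cptX hH).
have [P1 [P2 [iP PU PV]]] :=
  index_pair_exists cptX hH cK AK eA oU oV KU AV VK.
exists P1, P2; split=> //.
by apply: (subset_trans PV); rewrite -open_subsetE.
Qed.
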